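(* Let $\mathcal{L}$ be a pro-solvable Lie algebra. Then the family $\operatorname{ad}(\mathcal{L})$ is triangularizable.
   Context: All Lie algebras and vector spaces are over $\mathbb{C}$ and have a countable Hamel basis. For a Lie algebra $\mathcal{L}$ put $\mathcal{L}^{[1]}=\mathcal{L}$, $\mathcal{L}^{[k+1]}=[\mathcal{L}^{[k]},\mathcal{L}^{[k]}]$. An infinite-dimensional Lie algebra $\mathcal{L}$ is pro-solvable if $\bigcap_{i\ge1}\mathcal{L}^{[i]}=0$ and $\dim(\mathcal{L}/\mathcal{L}^{[i+1]})<\infty$ for all $i\ge1$. The family $\operatorname{ad}(\mathcal{L})$ is triangularizable if there is a chain of ideals $\mathcal{L}=\mathcal{V}_1\supset\mathcal{V}_2\supset\cdots\supset\mathcal{V}_i\supset\mathcal{V}_{i+1}\supset\cdots\supset\{0\}$ with $\dim(\mathcal{V}_i/\mathcal{V}_{i+1})=1$, $\bigcap_i\mathcal{V}_i=\{0\}$ and $\operatorname{ad}(\mathcal{L})(\mathcal{V}_i)\subseteq\mathcal{V}_i$ for all $i\in\mathbb{N}$. *)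

(* Defs.v *)
From HB Require Import structures.
From mathcomp Require Import all_boot all_order all_algebra.
From mathcomp Require Import classical_sets functions cardinality reals.
From mathcomp Require Import complex.

Set Implicit Arguments.
Unset Strict Implicit.
Unset Printing Implicit Defensive.

Import Order.TTheory GRing.Theory Num.Theory.

Local Open Scope classical_set_scope.
Local Open Scope ring_scope.

Section Subspaces.
Context {K : fieldType} {V : lmodType K}.
Implicit Types (A B : set V) (n : nat).

Definition subspace A : Prop := submod_closed (mem A).

Definition linspan A : set V := smallest subspace A.

Definition linearly_independent A : Prop :=
  forall (s : seq V) (c : V -> K), uniq s -> (forall x, x \in s -> A x) ->
    \sum_(x <- s) c x *: x = 0 -> forall x, x \in s -> c x = 0.

Definition hamel_basis A : Prop :=
  linspan A = setT /\ linearly_independent A.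

Definition has_countable_hamel_basis : Prop :=
  exists A, hamel_basis A /\ countable A.

(* For subspaces B `<=` A: the classes of e_0, ..., e_(n-1) modulo B form a
   basis of the quotient space A / B. *)
Definition quotient_basis A B n (e : 'I_n -> V) : Prop :=
  [/\ forall i, A (e i),
      forall x, A x -> exists c : 'I_n -> K, B (x - \sum_i c i *: e i)
    & forall c : 'I_n -> K, B (\sum_i c i *: e i) -> forall i, c i = 0].

Definition quotient_dim A B n : Prop :=
  exists e : 'I_n -> V, quotient_basis A B e.

Definition quotient_finite_dim A B : Prop := exists n, quotient_dim A B n.

Definition infinite_dimensional : Prop :=
  ~ quotient_finite_dim [set: V] [set 0].

End Subspaces.

Arguments has_countable_hamel_basis {K} V.
Arguments infinite_dimensional {K} V.

HB.mixin Record Lmodule_isLieAlgebra (K : fieldType) L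
    of GRing.Lmodule K L := {
  lie_bracket : L -> L -> L;
  lie_bracket_linearl : forall y, linear (fun x => lie_bracket x y);
  lie_bracket_linearr : forall x, linear (lie_bracket x);
  lie_bracketxx : forall x, lie_bracket x x = 0;
  lie_jacobi : forall x y z,
    lie_bracket x (lie_bracket y z) + lie_bracket y (lie_bracket z x)
      + lie_bracket z (lie_bracket x y) = 0
}.

#[short(type="lieAlgType")]
HB.structure Definition LieAlgebra (K : fieldType) :=
  { L of GRing.Lmodule K L & Lmodule_isLieAlgebra K L }.

Section LieAlgebras.
Context {K : fieldType} {L : lieAlgType K}.
Implicit Types (A B I : set L) (i : nat).

Definition ad (x : L) : L -> L := fun y => lie_bracket x y.

Definition commutator A B : set L :=
  linspan [set lie_bracket x y | x in A & y in B].

(* The usual numbering of the derived series starts at 1: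
   [derived_series i] is $\mathcal{L}^{[i+1]}$. *)
Fixpoint derived_series i : set L :=
  if i is j.+1 then commutator (derived_series j) (derived_series j)
  else [set: L].

Definition lie_ideal I : Prop :=
  subspace I /\ forall x y, I y -> I (lie_bracket x y).

Definition pro_solvable : Prop :=
  [/\ infinite_dimensional L,
      \bigcap_i derived_series i = [set 0]
    & forall i, quotient_finite_dim [set: L] (derived_series i.+1)].

Definition family_invariant (F : set (L -> L)) A : Prop :=
  forall f, F f -> f @` A `<=` A.

(* [V i] is $\mathcal{V}_{i+1}$. *)
Definition ad_triangularizable : Prop :=
  exists V : nat -> set L,
    [/\ V 0%N = [set: L],
        forall i, lie_ideal (V i),
        forall i, V i.+1 `<=` V i /\ quotient_dim (V i) (V i.+1) 1,
        \bigcap_i V i = [set 0]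
      & forall i, family_invariant (range ad) (V i)].

End LieAlgebras.

Arguments pro_solvable {K} L.
Arguments ad_triangularizable {K} L.

(* Main.v *)
Require Import Defs.
From HB Require Import structures.
From mathcomp Require Import all_boot all_order all_algebra.
From mathcomp Require Import boolp classical_sets reals complex.
From mathcomp Require Import ring.
Set Implicit Arguments.
Unset Strict Implicit.
Unset Printing Implicit Defensive.
Import GRing.Theory.
Local Open Scope classical_set_scope.
Local Open Scope ring_scope.

(** Each term [D i] of the derived series is an ideal of finite codimension,
    and [D i] acts trivially on [D i / D i.+1]. So this finite-dimensional
    quotient is a module over a finite-dimensional solvable Lie algebra, and
    Lie's theorem gives it a complete flag of submodules, that is, a flag of
    ideals between [D i.+1] and [D i] ([derived_series_flag]). Infinite
    dimension forces [D i <> D i.+1] for every [i], for otherwise the series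
    would stabilize at its intersection 0, which would have finite codimension.
    Hence the finite flags can be glued into one infinite chain
    ([linked_concat]), and this chain is cofinal with the derived series, so its
    intersection is 0.

    Lie's theorem is proved without quotient spaces or representations: one
    works in [L] itself with congruences modulo an ideal [B]. An eigenvector
    modulo [B] for [D k.+1] is promoted to one for [D k] by adjoining one vector
    at a time: every subspace between [D k.+1] and [D k] is stable under
    brackets with [D k], and finite codimension makes the process stop
    ([subspace_ascent]).

    The promotion [eigen_mod_extend] is the invariance lemma of Lie's theorem
    in a form that avoids traces. Let [P] act on [v] modulo [B] by the weight
    [lam], let [P] be stable under bracketing with [x], let [X] be the
    operator of bracketing with [x], and let [p] be a nonzero polynomial of
    least degree with [p(X) v] in [B]. For [h] in [P], moving [h] past [q(X)]
    gives [h q(X) v = lam(h) q(X) v + lam([h,x]) q'(X) v + r(X) v] modulo [B],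
    where [r] has degree at most [deg q - 2]. For [q = p] the polynomial
    [lam([h,x]) p' + r] annihilates [v] modulo [B] and has smaller degree than
    [p], so it is 0, and in characteristic 0 its coefficient of degree [deg p
    - 1] gives [lam([h,x]) = 0]. Then [P] acts on every [q(X) v] by the weight
    [lam], and writing [p = q * ('X - mu)] makes [q(X) v] an eigenvector of
    [x] as well. *)

(** * Congruence modulo a subspace *)

Section Congruence.
Context {K : fieldType} {V : lmodType K}.
Implicit Types (B : set V) (x y z : V).

Definition congr_mod B x y := B (x - y).

Lemma subspace_0 B : subspace B -> B 0.
Proof. by case=> [/set_mem]. Qed.

Lemma subspace_lin B a x y : subspace B -> B x -> B y -> B (a *: x + y).
Proof. by case=> _ sB Bx By; apply/set_mem/sB; apply/mem_set. Qed.

Lemma subspace_intro B :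
  B 0 -> (forall a x y, B x -> B y -> B (a *: x + y)) -> subspace B.
Proof.
move=> B0 Blin; split; first exact/mem_set.
by move=> a x y /set_mem Bx /set_mem By; apply/mem_set/Blin.
Qed.

Lemma subspace_scale B a x : subspace B -> B x -> B (a *: x).
Proof.
move=> sB Bx; rewrite -[_ *: _]addr0; apply: subspace_lin => //.
exact: subspace_0.
Qed.

Lemma subspace_add B x y : subspace B -> B x -> B y -> B (x + y).
Proof. by move=> sB Bx By; rewrite -[x]scale1r; exact: subspace_lin. Qed.

Lemma subspace_sub B x y : subspace B -> B x -> B y -> B (x - y).
Proof.
by move=> sB Bx By; rewrite addrC -scaleN1r; exact: subspace_lin.
Qed.

Lemma subspace_sum B (I : Type) (s : seq I) (F : I -> V) :
  subspace B -> (forall i, B (F i)) -> B (\sum_(i <- s) F i).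
Proof.
move=> sB BF; elim/big_ind: _ => //; first exact: subspace_0.
by move=> x y; exact: subspace_add.
Qed.

Lemma congr_mod_refl B x : subspace B -> congr_mod B x x.
Proof. by move=> sB; rewrite /congr_mod subrr; exact: subspace_0. Qed.

Lemma congr_mod_trans B x y z : subspace B ->
  congr_mod B x y -> congr_mod B y z -> congr_mod B x z.
Proof.
move=> sB Bxy Byz; rewrite /congr_mod -(subrKA y); exact: subspace_add.
Qed.

Lemma congr_mod_add B x x' y y' : subspace B ->
  congr_mod B x x' -> congr_mod B y y' -> congr_mod B (x + y) (x' + y').
Proof.
by move=> sB Bx By; rewrite /congr_mod opprD addrACA; exact: subspace_add.
Qed.

Lemma congr_mod_scale B a x x' : subspace B ->
  congr_mod B x x' -> congr_mod B (a *: x) (a *: x').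
Proof.
by move=> sB Bx; rewrite /congr_mod -scalerBr; exact: subspace_scale.
Qed.

Lemma congr_mod_mem B x y : subspace B -> congr_mod B x y -> B x -> B y.
Proof.
move=> sB Bxy Bx; rewrite -[y](subKr x); exact: subspace_sub.
Qed.

Definition adjoin B x : set V := [set y | exists c, congr_mod B y (c *: x)].

Lemma adjoin_subset B x : B `<=` adjoin B x.
Proof. by move=> y By; exists 0; rewrite /congr_mod scale0r subr0. Qed.

Lemma adjoin_mem B x : subspace B -> adjoin B x x.
Proof. by move=> sB; exists 1; rewrite scale1r; exact: congr_mod_refl. Qed.

Lemma subspace_adjoin B x : subspace B -> subspace (adjoin B x).
Proof.
move=> sB; apply: subspace_intro.
  by apply: adjoin_subset; exact: subspace_0.
move=> a y z [c yc] [d zd]; exists (a * c + d).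
rewrite scalerDl -scalerA; apply: congr_mod_add => //.
exact: congr_mod_scale.
Qed.

Lemma adjoin_sub B (A : set V) x :
  subspace A -> B `<=` A -> A x -> adjoin B x `<=` A.
Proof.
move=> sA BA Ax y [c /BA yc]; rewrite -(subrK (c *: x) y).
by apply: subspace_add => //; exact: subspace_scale.
Qed.

Lemma quotient_dim0 B (A : set V) : quotient_dim A B 0 -> A `<=` B.
Proof.
by move=> [e [_ gen _]] x /gen[c]; rewrite big_ord0 subr0.
Qed.

Lemma quotient_dim_adjoin_1 B x :
  subspace B -> ~ B x -> quotient_dim (adjoin B x) B 1.
Proof.
move=> sB nBx; exists (fun=> x); split => [_|y [c yc]|c].
- exact: adjoin_mem.
- by exists (fun=> c); rewrite big_ord1.
rewrite big_ord1 => Bcx i; rewrite ord1.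
have [//|c0] := eqVneq (c ord0) 0.
by case: nBx; rewrite -[x](scalerK c0); exact: subspace_scale.
Qed.

(** Exchange argument: some coordinate [c j] of [x] is nonzero, so [x] can
    replace the basis vector [e j], and the remaining [e i] are a basis modulo
    the enlarged subspace. *)
Lemma quotient_dim_adjoin A B n x : subspace B -> A x -> ~ B x ->
  quotient_dim A B n.+1 -> quotient_dim A (adjoin B x) n.
Proof.
move=> sB Ax nBx [e [Ae gen free]].
have [c xc] := gen x Ax.
have [j cj0] : exists j, c j != 0.
  apply: contrapT => /forallNP c0; apply: nBx.
  rewrite -[x]subr0; rewrite [in X in B X](_ : 0 = \sum_i c i *: e i) //.
  by rewrite big1 // => i _; have /negP/negPn/eqP-> := c0 i; rewrite scale0r.
exists (e \o lift j); split => [i|y Ay|a [t]]; first exact: Ae.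
  have [d yd] := gen y Ay.
  (* [t] is the coordinate of [y] on [x] once [x] replaces [e j]. *)
  pose t := d j / c j.
  exists (fun i => d (lift j i) - t * c (lift j i)), t.
  rewrite /congr_mod.
  have -> : y - \sum_i (d (lift j i) - t * c (lift j i)) *: (e \o lift j) i
              - t *: x =
            (- t) *: (x - \sum_i c i *: e i) + (y - \sum_i d i *: e i).
    rewrite (bigD1_ord j) //= [X in _ + (_ - X)](bigD1_ord j) //=.
    under eq_bigr do rewrite scalerBl -scalerA.
    rewrite sumrB -scaler_sumr !scalerBr scalerDr scalerA mulNr.
    rewrite !scaleNr {2}/t divfK //.
    set p := \sum_(i < n) _; set q := \sum_(i < n) _.
    rewrite !opprD !opprK.
    rewrite -/t [RHS](AC ((1*2)*(1*2)) ((2*5)*((4*(6*3))*1))) /=.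
    by rewrite subrr add0r.
  exact: subspace_lin.
rewrite /congr_mod.
move=> Bt.
(* Coordinates of the relation in the original basis; [e j] only occurs
   through [x], so the coordinate [b j = - t * c j] isolates [t]. *)
pose b i := oapp a 0 (unlift j i) - t * c i.
have /free b0 : B (\sum_i b i *: e i).
  have -> : \sum_i b i *: e i =
      t *: (x - \sum_i c i *: e i) + (\sum_i a i *: (e \o lift j) i - t *: x).
    under eq_bigr do rewrite scalerBl -scalerA.
    rewrite sumrB -scaler_sumr (bigD1_ord j) //= unlift_none /= scale0r add0r.
    under eq_bigr do rewrite liftK /=.
    by rewrite scalerBr [RHS]addrC subrKA.
  exact: subspace_lin.
have t0 : t = 0.
  have /eqP := b0 j; rewrite /b unlift_none /= sub0r oppr_eq0 mulf_eq0.
  by rewrite (negbTE cj0) orbF => /eqP.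
by move=> i; have := b0 (lift j i); rewrite /b liftK /= t0 mul0r subr0.
Qed.

(** Induction on the codimension of [B] in the whole space. Since that
    codimension drops by one with each adjoined vector, no dimension for [A]
    relative to [B] has to be known beforehand. *)
Lemma subspace_ascent (A B : set V) n (Q : set V -> Prop) :
    subspace A -> subspace B -> quotient_dim [set: V] B n ->
    B `<=` A -> Q B ->
    (forall P m, subspace P -> quotient_dim [set: V] P m ->
       B `<=` P -> P `<=` A ->
       (exists2 x, A x & ~ P x) -> Q P ->
       exists x, [/\ A x, ~ P x & Q (adjoin P x)]) ->
  Q A.
Proof.
move=> sA sB dimB BA QB step.
have ind m P : subspace P -> quotient_dim [set: V] P m ->
    B `<=` P -> P `<=` A -> Q P -> Q A.
  elim: m P => [|m IHm] P sP dimP BP PA QP;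
    have [AP|nAP] := pselect (A `<=` P).
  - by have <- : P = A by apply/seteqP.
  - by case: nAP => x _; exact: (quotient_dim0 dimP).
  - by have <- : P = A by apply/seteqP.
  have [|x [Ax nPx Qx]] := step P _ sP dimP BP PA _ QP.
    by move/existsNP: nAP => [x] /not_implyP[Ax nPx]; exists x.
  apply: IHm Qx; first exact: subspace_adjoin.
  - exact: quotient_dim_adjoin.
  - exact: subset_trans BP (@adjoin_subset _ _).
  - exact: adjoin_sub.
exact: (ind n B).
Qed.

End Congruence.

(** * Polynomials in a linear endomorphism *)

Section PolynomialAction.
Context {K : fieldType} {V : lmodType K}.
Variable f : {linear V -> V}.
Implicit Types (p q : {poly K}) (v : V) (A B : set V).

Definition poly_act p v := \sum_(i < size p) p`_i *: iter i f v.

(** The sum may run past the size of [p]; this common range is what makes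
    additivity in [p] a termwise statement. *)
Lemma poly_actE n p v :
  (size p <= n)%N -> poly_act p v = \sum_(i < n) p`_i *: iter i f v.
Proof.
move=> pn; rewrite /poly_act (big_ord_widen n (fun i => p`_i *: iter i f v)) //.
rewrite big_mkcond; apply: eq_bigr => i _; case: ltnP => // pi.
by rewrite nth_default // scale0r.
Qed.

Lemma poly_actD p q v : poly_act (p + q) v = poly_act p v + poly_act q v.
Proof.
pose n := maxn (size p) (size q).
rewrite (@poly_actE n) ?size_polyD // (@poly_actE n p) ?leq_maxl //.
rewrite (@poly_actE n q) ?leq_maxr // -big_split /=.
by apply: eq_bigr => i _; rewrite coefD scalerDl.
Qed.

Lemma poly_actZ a p v : poly_act (a *: p) v = a *: poly_act p v.
Proof.
rewrite (@poly_actE (size p)) ?size_scale_leq // scaler_sumr.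
by apply: eq_bigr => i _; rewrite coefZ scalerA.
Qed.

Lemma poly_actC a v : poly_act a%:P v = a *: v.
Proof.
by rewrite (@poly_actE 1) ?size_polyC_leq1 // big_ord1 coefC.
Qed.

Lemma poly_actMX p v : poly_act (p * 'X) v = f (poly_act p v).
Proof.
rewrite (@poly_actE (size p).+1); last first.
  by rewrite (leq_trans (size_polyMleq _ _)) // size_polyX addn2.
rewrite big_ord_recl coefMX /= scale0r add0r linear_sum.
by apply: eq_bigr => i _; rewrite coefMX /= linearZ.
Qed.

Lemma poly_act_mem A p v :
  subspace A -> (forall y, A y -> A (f y)) -> A v -> A (poly_act p v).
Proof.
move=> sA fA Av; apply: subspace_sum => // i; apply: subspace_scale => //.
by elim: (nat_of_ord i) => //= k; exact: fA.
Qed.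

(** The [n + 1] vectors [v, f v, ..., f^n v] have coordinates in an
    [n]-dimensional space, so their coordinate matrix has a nonzero left
    kernel. *)
Lemma poly_act_annihilator B n v : subspace B -> quotient_dim [set: V] B n ->
  exists2 p, p != 0 & B (poly_act p v).
Proof.
move=> sB [e [_ gen _]].
have [c vc] := choice (fun k => gen (iter k f v) I).
pose M := \matrix_(k < n.+1, i < n) c k i.
have : kermx M != 0.
  by rewrite kermx_eq0 /row_free ltn_eqF // (leq_ltn_trans (rank_leq_col _)).
move=> /rowV0Pn[u /sub_kermxP uM u0].
exists (\poly_(k < n.+1) u 0 (inord k)).
  apply: contra_neq u0 => p0; apply/rowP => k; rewrite mxE.
  have := congr1 (fun p => p`_k) p0.
  by rewrite coef_poly ltn_ord coef0 inord_val.
rewrite (@poly_actE n.+1) ?size_poly //.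
have -> : \sum_(k < n.+1) (\poly_(k < n.+1) u 0 (inord k))`_k *: iter k f v
    = \sum_(k < n.+1) u 0 k *: (iter k f v - \sum_i c k i *: e i).
  under [RHS]eq_bigr do rewrite scalerBr.
  rewrite sumrB; under [X in _ = _ - X]eq_bigr do rewrite scaler_sumr.
  rewrite exchange_big [X in _ = _ - X]big1 ?subr0 => [|i _].
    by apply: eq_bigr => k _; rewrite coef_poly ltn_ord inord_val.
  have /rowP/(_ i) := uM; rewrite !mxE => ui.
  under eq_bigr do rewrite scalerA.
  rewrite -scaler_suml -[RHS](scale0r (e i)); congr (_ *: _).
  by rewrite -[RHS]ui; apply: eq_bigr => k _; rewrite mxE.
by apply: subspace_sum => // k; apply: subspace_scale.
Qed.

Lemma minimal_annihilator B v :
    (exists2 p, p != 0 & B (poly_act p v)) ->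
  exists p, [/\ p != 0, B (poly_act p v) &
    forall q, B (poly_act q v) -> (size q < size p)%N -> q = 0].
Proof.
move=> [p p0 Bp].
pose S m := `[< exists p, [/\ p != 0, size p = m & B (poly_act p v)] >].
have [|m /asboolP[q [q0 <- Bq]] qmin] := @ex_minnP S.
  by exists (size p); apply/asboolP; exists p.
exists q; split => // r Br rq; apply: contraTeq rq => r0.
by rewrite -leqNgt; apply: qmin; apply/asboolP; exists r.
Qed.

End PolynomialAction.

(** * Gluing finite chains *)

Section Chains.
Context {T : Type} (r : T -> T -> Prop).

Definition linked (a b : T) := exists n (F : nat -> T),
  [/\ F 0%N = a, F n = b & forall j, (j < n)%N -> r (F j) (F j.+1)].

Lemma linked_refl a : linked a a.
Proof. by exists 0%N, (fun=> a). Qed.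

Lemma linked_cons a b c : r a b -> linked b c -> linked a c.
Proof.
move=> rab [n [F [F0 Fn Fr]]]; exists n.+1.
exists (fun j => if j is k.+1 then F k else a).
by split=> // -[|j] /=; [rewrite F0|exact: Fr].
Qed.

(** The gluing runs through pairs (i, j), position [j] in the chain from [D i]
    to [D i.+1]. Because [D i] differs from [D i.+1] each chain has positive
    length, so every step of the walk on pairs is a genuine [r]-step and every
    [(i, 0)] is reached. *)
Lemma linked_concat (D : nat -> T) :
    (forall i, linked (D i) (D i.+1)) -> (forall i, D i <> D i.+1) ->
  exists V : nat -> T, [/\ V 0%N = D 0%N, forall m, r (V m) (V m.+1)
    & forall i, exists m, V m = D i].
Proof.
move=> linkD neqD.
have /choice[len /choice[F FP]] := linkD.
have len_gt0 i : (0 < len i)%N.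
  have [F0 Fl _] := FP i; rewrite lt0n; apply/eqP => l0.
  by apply: (neqD i); rewrite -F0 -Fl l0.
pose next (s : nat * nat) :=
  if (s.2.+1 < len s.1)%N then (s.1, s.2.+1) else (s.1.+1, 0%N).
pose V m := let s := iter m next (0, 0)%N in F s.1 s.2.
have inv m : let s := iter m next (0, 0)%N in (s.2 < len s.1)%N.
  by elim: m => [|m IHm] //=; rewrite /next; case: ifP.
have reach i : exists m, iter m next (0, 0)%N = (i, 0)%N.
  elim: i => [|i [m im]]; first by exists 0%N.
  (* From (i, 0) the walk stays in the i-th chain until it is exhausted. *)
  have climb j : (j < len i)%N -> iter (j + m) next (0, 0)%N = (i, j).
    elim: j => [|j IHj] jl; first by rewrite im.
    by rewrite addSn iterS IHj 1?ltnW // /next jl.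
  exists ((len i).-1 + m).+1; rewrite iterS climb ?prednK //.
  by rewrite /next /= prednK // ltnn.
exists V; split => [|m|i].
- by rewrite /V /=; case: (FP 0%N).
- rewrite /V iterS; move: (inv m) => /=; case: (iter m next _) => i j /= jl.
  have [F0 Fl Fr] := FP i; rewrite /next /=.
  case: ltnP => jl' /=; first exact: Fr.
  have [-> _ _] := FP i.+1; rewrite -Fl.
  by have -> : len i = j.+1; [apply/eqP; rewrite eqn_leq jl' jl|exact: Fr].
- by have [m im] := reach i; exists m; rewrite /V im; case: (FP i).
Qed.

End Chains.

(** * Ideals and the derived series *)

Section LieAlgebraBasics.
Context {K : fieldType} {L : lieAlgType K}.
Implicit Types (A B P : set L) (x y z h v : L) (k n : nat).

HB.instance Definition _ x :=
  GRing.isLinear.Build K L L *:%R (lie_bracket x) (lie_bracket_linearr x).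

(** The flipped bracket is named so that linearity in the first argument can be
    registered too. *)
Definition lie_bracketr y x := lie_bracket x y.

HB.instance Definition _ y :=
  GRing.isLinear.Build K L L *:%R (lie_bracketr y) (lie_bracket_linearl y).

Lemma lie_bracket_anti x y : lie_bracket x y = - lie_bracket y x.
Proof.
apply/eqP; rewrite -addr_eq0; apply/eqP.
have := lie_bracketxx (x + y).
have bD z : lie_bracket (x + y) z = lie_bracket x z + lie_bracket y z.
  exact: (linearD (lie_bracketr z)).
by rewrite bD !linearD /= !lie_bracketxx add0r addr0 addrC.
Qed.

Lemma lie_bracket_leibniz x y z :
  lie_bracket x (lie_bracket y z) =
  lie_bracket (lie_bracket x y) z + lie_bracket y (lie_bracket x z).
Proof.
apply/eqP; rewrite -subr_eq0 -(lie_jacobi x y z) opprD addrA.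
rewrite (lie_bracket_anti (lie_bracket x y)) opprK.
by rewrite (lie_bracket_anti x z) linearN opprK addrAC.
Qed.

(** By the Leibniz rule, bracketing a generator [[a, b]] with [x] gives a sum
    of two generators; the vectors sent into the commutator by bracketing with
    [x] form a subspace, so this suffices. *)
Lemma commutator_ideal A : lie_ideal A -> lie_ideal (commutator A A).
Proof.
move=> iA; have sC : subspace (commutator A A).
  apply: subspace_intro => [|a y z Cy Cz] C [sC genC]; first exact: subspace_0.
  by apply: subspace_lin => //; [apply: Cy|apply: Cz].
split=> // x.
apply: (@smallest_sub _ _ _ [set y | commutator A A (lie_bracket x y)]).
  apply: subspace_intro => /= [|a y z Cy Cz].
    by rewrite linear0; exact: subspace_0.
  by rewrite linearP /=; exact: (subspace_lin a sC Cy Cz).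
move=> _ [a Aa [b Ab <-]] /=; rewrite lie_bracket_leibniz.
apply: (subspace_add sC) => C [_]; apply.
  by exists (lie_bracket x a); [exact: iA.2|exists b].
by exists a => //; exists (lie_bracket x b); [exact: iA.2|].
Qed.

Lemma derived_series_ideal k : lie_ideal (derived_series k : set L).
Proof.
elim: k => [|k IHk]; last exact: commutator_ideal.
by split=> //; exact: subspace_intro.
Qed.

Lemma derived_series_bracket k x y :
  derived_series k x -> derived_series k y ->
  derived_series k.+1 (lie_bracket x y).
Proof. by move=> Dx Dy C [_]; apply; exists x => //; exists y. Qed.

Lemma derived_series_decr k :
  derived_series k.+1 `<=` (derived_series k : set L).
Proof.
have [sD iD] := derived_series_ideal k.
by apply: smallest_sub => // _ [a _ [b Db <-]]; exact: iD.
Qed.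

Definition flag_step A B :=
  [/\ lie_ideal A, lie_ideal B, B `<=` A & quotient_dim A B 1].

(** The weight is left implicit, as one existential for each [h], so that
    enlarging [P] does not require extending a weight function. *)
Definition eigen_mod B P v :=
  forall h, P h -> exists c, congr_mod B (lie_bracket h v) (c *: v).

End LieAlgebraBasics.

(** * Lie's theorem modulo an ideal *)

Section LieTheorem.
Context {K : closedFieldType} {L : lieAlgType K}.
Hypothesis pchar0 : [pchar K] =i pred0.
Implicit Types (A B P : set L) (x y z h v : L) (k n : nat).

(** The invariance lemma and the choice of an eigenvector in one step: [w] is
    [q(X) v], where [X] is bracketing with [x] and [q] is a minimal annihilating
    polynomial of [v] modulo [B] deprived of one linear factor. *)
Lemma eigen_mod_extend A B P n x v :
    lie_ideal A -> lie_ideal B -> quotient_dim [set: L] B n ->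
    (forall h, P h -> P (lie_bracket h x)) ->
    A v -> ~ B v -> eigen_mod B P v ->
  exists w, [/\ A w, ~ B w, eigen_mod B P w & eigen_mod B [set x] w].
Proof.
move=> [sA iA] [sB iB] dimB Px Av nBv.
have cbr h y z : congr_mod B y z ->
    congr_mod B (lie_bracket h y) (lie_bracket h z).
  by rewrite /congr_mod -linearB; exact: iB.
pose act p := poly_act (lie_bracket x) p v.
move=> ev.
have /choice[lam lamP] h : exists c, P h ->
    congr_mod B (lie_bracket h v) (c *: v).
  have [/ev[c hc]|nPh] := pselect (P h); first by exists c.
  by exists 0.
have hx h w : lie_bracket h (lie_bracket x w) =
    lie_bracket (lie_bracket h x) w + lie_bracket x (lie_bracket h w).
  exact: lie_bracket_leibniz.
(* Moving [h] past [q(X)]: the first-order correction is a derivative in [q].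
   The statement has to hold for all [h] at once, because the induction also
   uses it for [[h, x]]. *)
have expand (q : {poly K}) h : P h ->
  exists2 r : {poly K}, (size r <= (size q).-2)%N &
    congr_mod B (lie_bracket h (act q))
      (act (lam h *: q + lam (lie_bracket h x) *: q^`() + r)).
  elim/poly_ind: q h => [|q c IHq] h Ph.
    exists 0; first by rewrite size_poly0.
    rewrite deriv0 !scaler0 !addr0 /act /poly_act size_poly0 !big_ord0.
    by rewrite linear0; exact: congr_mod_refl.
  have actE : act (q * 'X + c%:P) = lie_bracket x (act q) + c *: v.
    by rewrite /act poly_actD poly_actMX poly_actC.
  have [r rq hr] := IHq h Ph.
  have [r1 r1q hr1] := IHq _ (Px _ Ph).
  set g := lie_bracket h x in hr1 hr *.
  exists (lam (lie_bracket g x) *: q^`() + r1 + r * 'X).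
    have [q0|q0] := eqVneq q 0.
      move: rq r1q; rewrite q0 size_poly0 !leqn0 !size_poly_eq0.
      move=> /eqP-> /eqP->; rewrite deriv0 scaler0 mul0r !addr0.
      by rewrite size_poly0.
    rewrite size_MXaddC (negbTE q0) /=.
    rewrite (leq_trans (size_polyD _ _)) // geq_max.
    rewrite (leq_trans (size_polyD _ _)) ?geq_max /=; last first.
      apply/andP; split; last by rewrite (leq_trans r1q) ?leq_pred.
      rewrite (leq_trans (size_scale_leq _ _)) // -ltnS prednK.
        by rewrite lt_size_deriv.
      by rewrite size_poly_gt0.
    have [->|r0] := eqVneq r 0; first by rewrite mul0r size_poly0.
    rewrite size_mulX //; move: rq; rewrite -size_poly_gt0 in r0.
    case: (size q) => [|[|m]] /=; rewrite ?leqn0 ?ltnS // => /eqP rs;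
      by rewrite rs in r0.
  rewrite actE linearD linearZ /= hx.
  have -> : lam h *: (q * 'X + c%:P) + lam g *: (q * 'X + c%:P)^`() +
      (lam (lie_bracket g x) *: q^`() + r1 + r * 'X) =
      (lam g *: q + lam (lie_bracket g x) *: q^`() + r1) +
      (lam h *: q + lam g *: q^`() + r) * 'X + (c * lam h)%:P.
    rewrite derivD derivM derivX derivC -!mul_polyC polyCM; ring.
  rewrite /act 2!poly_actD poly_actMX poly_actC -scalerA.
  apply: (congr_mod_add sB); last by apply: (congr_mod_scale _ sB); exact: lamP.
  by apply: (congr_mod_add sB) => //; exact: cbr.
have [|p [p0 Bp pmin]] := @minimal_annihilator _ _ (lie_bracket x) B v.
  exact: poly_act_annihilator dimB.
(* A nonzero constant cannot annihilate [v], which is not in [B]. *)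
have p2 : (1 < size p)%N.
  rewrite ltnNge; apply/negP => /size1_polyC pE.
  apply: nBv; move: Bp; rewrite pE poly_actC => Bp.
  have c0 : p`_0 != 0 by rewrite -polyC_eq0 -pE.
  by rewrite -[v](scalerK c0); exact: (subspace_scale _ sB).
have lam0 h : P h -> lam (lie_bracket h x) = 0.
  move=> Ph; have [r rp hr] := expand p h Ph.
  set g := lie_bracket h x in hr *.
  pose q := lam g *: p^`() + r.
  have Bq : B (act q).
    have : B (act (lam h *: p + q)).
      by rewrite /q addrA; apply: congr_mod_mem hr _ => //; exact: iB.
    rewrite /act poly_actD poly_actZ => Bq.
    rewrite -[X in B X](addKr (lam h *: poly_act (lie_bracket x) p v)).
    rewrite addrC; apply: subspace_sub => //; exact: subspace_scale.
  have dp : (size p^`() < size p)%N by rewrite lt_size_deriv.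
  have /(pmin q Bq) q0 : (size q < size p)%N.
    rewrite (leq_ltn_trans (size_polyD _ _)) // gtn_max.
    rewrite (leq_ltn_trans (size_scale_leq _ _)) //=.
    by rewrite (leq_ltn_trans rp) // -subn2 ltn_subrL /= ltnW.
  (* [r] has no coefficient in degree [deg p - 1], where [p'] has [deg p]
     times the leading coefficient of [p]. *)
  have := congr1 (fun s : {poly K} => s`_(size p).-2) q0.
  rewrite coef0 /q coefD coefZ coef_deriv.
  rewrite [r`_ _]nth_default // addr0 prednK ?ltn_predRL //.
  rewrite -mulr_natr => /eqP; rewrite !mulf_eq0 -lead_coefE lead_coef_eq0.
  rewrite (negbTE p0) /= ((pcharf0P K).1 pchar0) orbC => /orP[|/eqP//].
  by rewrite -leqn0 leqNgt ltn_predRL p2.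
have weights s h : P h -> congr_mod B (lie_bracket h (act s)) (lam h *: act s).
  elim/poly_ind: s h => [|s c IHs] h Ph.
    rewrite /act /poly_act size_poly0 !big_ord0 scaler0 linear0.
    exact: congr_mod_refl.
  rewrite /act poly_actD poly_actMX poly_actC linearD linearZ scalerDr /= hx.
  apply: (congr_mod_add sB); last first.
    rewrite scalerA mulrC -scalerA; apply: (congr_mod_scale _ sB); exact: lamP.
  rewrite -[X in congr_mod B _ X]add0r -linearZ.
  apply: (congr_mod_add sB); last exact/cbr/IHs.
  by rewrite -[0](scale0r (act s)) -(lam0 h Ph); apply: IHs; exact: Px.
have /closed_rootP[mu /factor_theorem[q pE]] : size p != 1 by rewrite gtn_eqF.
have q0 : q != 0 by apply: contraNneq p0 => q0; rewrite pE q0 mul0r.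
exists (act q); split.
- by apply: poly_act_mem => //; exact: iA.
- move=> /pmin qp; case/eqP: (q0); apply: qp.
  by rewrite pE (size_Mmonic q0 (monicXsubC _)) size_XsubC addn2.
- by move=> h Ph; exists (lam h); exact: weights.
move=> _ ->; exists mu; move: Bp.
have -> : p = q * 'X + (- mu) *: q by rewrite pE -mul_polyC polyCN; ring.
by rewrite poly_actD poly_actMX poly_actZ scaleNr.
Qed.

Lemma eigen_mod_adjoin B P x w : subspace B ->
  eigen_mod B P w -> eigen_mod B [set x] w -> eigen_mod B (adjoin P x) w.
Proof.
move=> sB eP ex h [c /eP[a ha]].
have [b hb] := ex x erefl; exists (a + c * b).
rewrite -(subrK (c *: x) h) scalerDl.
have -> : lie_bracket (h - c *: x + c *: x) w =
    lie_bracket (h - c *: x) w + c *: lie_bracket x w.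
  by rewrite -(linearZ_LR (lie_bracketr w)); exact: (linearD (lie_bracketr w)).
apply: (congr_mod_add sB) => //; rewrite -scalerA.
exact: (congr_mod_scale _ sB).
Qed.

Hypothesis derived_series_fin :
  forall i, quotient_finite_dim [set: L] (derived_series i.+1).

(** Lie's theorem for the module [A / B], on which [D k] acts by zero: the zero
    weight of [D k] is promoted successively to [D k.-1, ..., D 0 = L]. *)
Lemma common_eigenvector A B k n :
    lie_ideal A -> lie_ideal B -> quotient_dim [set: L] B n ->
    (forall h a, derived_series k h -> A a -> B (lie_bracket h a)) ->
    (exists2 x, A x & ~ B x) ->
  exists w, [/\ A w, ~ B w & eigen_mod B [set: L] w].
Proof.
move=> iA iB dimB kA [x Ax nBx].
have : exists w, [/\ A w, ~ B w & eigen_mod B (derived_series k) w].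
  exists x; split=> // h /kA Bh; exists 0; rewrite /congr_mod scale0r subr0.
  exact: Bh.
elim: k {kA x Ax nBx} => [//|k IHk] Dk; apply: IHk.
have [m dimD] := derived_series_fin k.
have DkS := @derived_series_decr _ L k.
apply: (@subspace_ascent _ _ _ _ _
  (fun P => exists w, [/\ A w, ~ B w & eigen_mod B P w])
  (derived_series_ideal k).1 (derived_series_ideal k.+1).1 dimD
  DkS Dk).
move=> P d sP _ DP PD [y Dy nPy] [w [Aw nBw ew]]; exists y; split=> //.
have [|//|z [Az nBz ez ezy]] :=
  @eigen_mod_extend A B P n y w iA iB dimB _ Aw nBw.
  by move=> h /PD Dh; apply: DP; exact: derived_series_bracket.
by exists z; split=> //; apply: eigen_mod_adjoin => //; case: iB.
Qed.

Lemma lie_ideal_adjoin P x :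
  lie_ideal P -> eigen_mod P [set: L] x -> lie_ideal (adjoin P x).
Proof.
move=> [sP iP] ex; split; first exact: subspace_adjoin.
move=> h y [c yc]; have [a ha] := ex h I; exists (c * a).
rewrite -scalerA.
apply: (@congr_mod_trans _ _ _ _ (c *: lie_bracket h x)) => //.
  by rewrite /congr_mod -linearZ -linearB; exact: iP.
exact: (congr_mod_scale _ sP).
Qed.

(** Starting from [D i.+1], each ideal below [D i] is enlarged by a common
    eigenvector of [L] modulo it; this applies because brackets of elements of
    [D i] already lie in [D i.+1]. *)
Lemma derived_series_flag i :
  linked flag_step (derived_series i : set L) (derived_series i.+1).
Proof.
have [m dimD] := derived_series_fin i.
have iD := @derived_series_ideal _ L.
suff [] : lie_ideal (derived_series i : set L) /\
    linked flag_step (derived_series i : set L) (derived_series i.+1) by [].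
apply: (@subspace_ascent _ _ _ (derived_series i.+1) m
  (fun P => lie_ideal P /\ linked flag_step P (derived_series i.+1))) => //.
- by case: (iD i).
- by case: (iD i.+1).
- exact: derived_series_decr.
- by split=> //; exact: linked_refl.
move=> P n sP dimP DP PD DnP [iP lP].
have [|x [Dx nPx ex]] :=
    @common_eigenvector _ _ i _ (iD i) iP dimP _ DnP.
  by move=> h a Dh Da; apply: DP; exact: derived_series_bracket.
exists x; split=> //; have iPx := lie_ideal_adjoin iP ex.
split=> //; apply: linked_cons lP; split=> //.
  exact: adjoin_subset.
exact: quotient_dim_adjoin_1.
Qed.

(** A repeated term makes the series constant from there on, so that term would
    be the intersection 0, while it has finite codimension. *)
Lemma derived_series_neq i :
  infinite_dimensional L -> \bigcap_i derived_series i = [set 0 : L] ->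
  derived_series i <> derived_series i.+1 :> set L.
Proof.
move=> infL capD eD; apply: infL.
suff <- : derived_series i.+1 = [set 0 : L] by [].
rewrite -capD; apply/seteqP; split => [x Dx k _|x]; last exact.
have stab j : derived_series (i + j) = derived_series i :> set L.
  elim: j => [|j IHj]; first by rewrite addn0.
  by rewrite addnS /= IHj [RHS]eD.
have [ki|/ltnW ik] := leqP k i; last by rewrite -(subnKC ik) stab eD.
rewrite -eD -(subnKC ki) in Dx.
elim: (i - k)%N Dx => [|j IHj]; first by rewrite addn0.
by rewrite addnS => /derived_series_decr.
Qed.

Lemma pro_solvable_ad_triangularizable :
  infinite_dimensional L -> \bigcap_i derived_series i = [set 0 : L] ->
  ad_triangularizable L.
Proof.
move=> infL capD.
have [V [V0 Vstep Vcof]] := linked_concat derived_series_flag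
  (fun i => @derived_series_neq i infL capD).
have iV i : lie_ideal (V i) by case: (Vstep i).
exists V; split => // [i||i].
- by case: (Vstep i).
- apply/seteqP; split => [x Vx|_ -> i _]; last exact: subspace_0 (iV i).1.
  by rewrite -capD => i _; have [m <-] := Vcof i; exact: Vx.
- by move=> _ [x _ <-] _ [y Vy <-]; exact: (iV i).2.
Qed.

End LieTheorem.

Theorem theorem2p6 (R : realType) (L : lieAlgType R[i])
  (hL : has_countable_hamel_basis L) (psL : pro_solvable L) :
  ad_triangularizable L.
Proof.
have [infL capD finD] := psL.
exact: pro_solvable_ad_triangularizable
  (@Num.Theory.pchar_num R[i]) finD infL capD.
Qed.
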